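(* Let $T$ be any first order theory (with signature $L$) such that every model of $T$ has at least two elements, and let $T^R$ be its randomization theory. Then every pre-complete model of $T^R$ has perfect witnesses. In particular, every model of $T^R$ has perfect witnesses.
   Context: Continuous logic is in the sense of Ben Yaacov–Usvyatsov; a pre-structure is a structure whose distance predicates are only pseudo-metrics, and a pre-model of a theory is a pre-structure satisfying all its conditions. A pre-structure is pre-complete if the reduced pre-structure obtained by identifying elements at distance $0$ is already complete in each sort (so it is a genuine continuous structure). The randomization signature $L^R$ is two-sorted with a sort $\mathbf{K}$ (random elements) and a sort $\mathbf{B}$ (events): for each first order $L$-formula $\varphi$ with $n$ free variables an $n$-ary function symbol $\llbracket\varphi(\cdot)\rrbracket$ of sort $\mathbf{K}^n\to\mathbf{B}$, a $[0,1]$-valued unary predicate $\mu$ on $\mathbf{B}$, Boolean operations $\top,\bot,\sqcup,\sqcap,\neg$ on $\mathbf{B}$, and distance predicates $d_\mathbf{K},d_\mathbf{B}$; all symbols are $1$-Lipschitz. Write $\mathsf U\doteq\mathsf V$ for $d_\mathbf{B}(\mathsf U,\mathsf V)=0$. The theory $T^R$ has the axioms: (Validity) $\sup_{\bar x} d_\mathbf{B}(\llbracket\psi(\bar x)\rrbracket,\top)=0$ whenever $\forall\bar x\,\psi(\bar x)$ is logically valid; (Boolean) the Boolean algebra axioms on $\mathbf{B}$ and $\llbracket\neg\varphi(\bar x)\rrbracket\doteq\neg\llbracket\varphi(\bar x)\rrbracket$, $\llbracket(\varphi\vee\psi)(\bar x)\rrbracket\doteq\llbracket\varphi(\bar x)\rrbracket\sqcup\llbracket\psi(\bar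 x)\rrbracket$, $\llbracket(\varphi\wedge\psi)(\bar x)\rrbracket\doteq\llbracket\varphi(\bar x)\rrbracket\sqcap\llbracket\psi(\bar x)\rrbracket$ for all $\bar x$; (Distance) $d_\mathbf{K}(x,y)=1-\mu\llbracket x=y\rrbracket$ and $d_\mathbf{B}(\mathsf U,\mathsf V)=\mu(\mathsf U\triangle\mathsf V)$; (Fullness) $\sup_{\bar y}\inf_x d_\mathbf{B}(\llbracket\varphi(x,\bar y)\rrbracket,\llbracket(\exists x\varphi)(\bar y)\rrbracket)=0$ for each $\varphi$; (Event) $\sup_{\mathsf U}\inf_{x,y} d_\mathbf{B}(\mathsf U,\llbracket x=y\rrbracket)=0$; (Measure) $\mu(\top)=1$, $\mu(\bot)=0$, $\mu(\mathsf U)+\mu(\mathsf V)=\mu(\mathsf U\sqcup\mathsf V)+\mu(\mathsf U\sqcap\mathsf V)$; (Atomless) $\sup_{\mathsf U}\inf_{\mathsf V}|\mu(\mathsf U\sqcap\mathsf V)-\mu(\mathsf U)/2|=0$; (Transfer) $\llbracket\varphi\rrbracket\doteq\top$ for each sentence $\varphi\in T$. A pre-model $(\mathcal K,\mathcal B)$ of $T^R$ has perfect witnesses if the Fullness and Event axioms hold with exact witnesses: for each formula $\varphi(x,\bar y)$ and tuple $\bar{\mathbf g}$ in $\mathcal K$ there is $\mathbf f\in\mathcal K$ with $\llbracket\varphi(\mathbf f,\bar{\mathbf g})\rrbracket\doteq\llbracket(\exists x\varphi)(\bar{\mathbf g})\rrbracket$, and for each $\mathsf B\in\mathcal B$ there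 are $\mathbf f,\mathbf g\in\mathcal K$ with $\mathsf B\doteq\llbracket\mathbf f=\mathbf g\rrbracket$. *)

(* Defs.v *)
From mathcomp Require Import all_boot all_order all_algebra.
From mathcomp Require Import boolp classical_sets reals.
Set Implicit Arguments.
Unset Strict Implicit.
Unset Printing Implicit Defensive.
Import Order.TTheory GRing.Theory Num.Theory.
Local Open Scope classical_set_scope.
Local Open Scope ring_scope.

(** * First order logic *)

(* Constants are function symbols of arity 0. *)
Record signature := Signature {
  fsym : Type; farity : fsym -> nat;
  rsym : Type; rarity : rsym -> nat }.

Inductive term (L : signature) : Type :=
| Var of nat
| App (f : fsym L) of ('I_(farity f) -> term L).

Inductive formula (L : signature) : Type :=
| Eq of term L & term L
| Rel (r : rsym L) of ('I_(rarity r) -> term L)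
| Not of formula L
| And of formula L & formula L
| Or of formula L & formula L
| Ex of nat & formula L
| All of nat & formula L.

Arguments Var {L} _.
Arguments Ex {L} _ _.
Arguments All {L} _ _.

Fixpoint tvars (L : signature) (t : term L) : seq nat :=
  match t with
  | Var x => [:: x]
  | App f ts => flatten [seq tvars (ts i) | i <- enum 'I_(farity f)]
  end.

(* The free variables, listed without repetition. *)
Fixpoint fv (L : signature) (phi : formula L) : seq nat :=
  match phi with
  | Eq s t => undup (tvars s ++ tvars t)
  | Rel r ts => undup (flatten [seq tvars (ts i) | i <- enum 'I_(rarity r)])
  | Not p => fv p
  | And p q | Or p q => undup (fv p ++ fv q)
  | Ex x p | All x p => [seq y <- fv p | y != x]
  end.

Definition sentence (L : signature) (phi : formula L) : Prop := fv phi = [::].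

Definition uclosure (L : signature) (phi : formula L) : formula L :=
  foldr All phi (fv phi).

Record fo_structure (L : signature) := FoStructure {
  fo_sort :> Type;
  fo_inhabited : inhabited fo_sort;
  fo_fun : forall f : fsym L, ('I_(farity f) -> fo_sort) -> fo_sort;
  fo_rel : forall r : rsym L, ('I_(rarity r) -> fo_sort) -> Prop }.

Definition upd (X : Type) (e : nat -> X) (x : nat) (a : X) : nat -> X :=
  fun y => if y == x then a else e y.

Fixpoint teval (L : signature) (A : fo_structure L) (e : nat -> A)
    (t : term L) : A :=
  match t with
  | Var x => e x
  | App f ts => fo_fun (fun i => teval e (ts i))
  end.

Fixpoint sat (L : signature) (A : fo_structure L) (e : nat -> A)
    (phi : formula L) : Prop :=
  match phi with
  | Eq s t => teval e s = teval e t
  | Rel r ts => fo_rel (fun i => teval e (ts i))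
  | Not p => ~ sat e p
  | And p q => sat e p /\ sat e q
  | Or p q => sat e p \/ sat e q
  | Ex x p => exists a : A, sat (upd e x a) p
  | All x p => forall a : A, sat (upd e x a) p
  end.

Definition holds (L : signature) (A : fo_structure L) (phi : formula L) : Prop :=
  forall e : nat -> A, sat e phi.

Definition logically_valid (L : signature) (phi : formula L) : Prop :=
  forall A : fo_structure L, holds A phi.

Definition fo_theory (L : signature) (T : set (formula L)) : Prop :=
  forall phi, T phi -> sentence phi.

Definition fo_model (L : signature) (T : set (formula L))
    (A : fo_structure L) : Prop :=
  forall phi, T phi -> holds A phi.

(** * Completeness of (pseudo-)metrics *)

Section Metric.
Context {R : realType} {X : Type}.
Implicit Types (d : X -> X -> R) (u : nat -> X).

Definition pseudometric01 d : Prop :=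
  [/\ forall x y, 0 <= d x y <= 1, forall x, d x x = 0,
      forall x y, d x y = d y x & forall x y z, d x z <= d x y + d y z].

Definition separated d : Prop := forall x y, d x y = 0 -> x = y.

Definition cauchy_seq d u : Prop :=
  forall eps : R, 0 < eps ->
    exists N : nat, forall m n, (N <= m)%N -> (N <= n)%N -> d (u m) (u n) < eps.

Definition cvg_seq d u (l : X) : Prop :=
  forall eps : R, 0 < eps ->
    exists N : nat, forall n, (N <= n)%N -> d (u n) l < eps.

Definition complete_dist d : Prop :=
  forall u, cauchy_seq d u -> exists l, cvg_seq d u l.

(* The quotient of X by the relation d x y = 0, as a set of classes. *)
Definition reduced d : Type :=
  {C : set X | exists x, C = [set y | d x y = 0]}.

(* When d is a pseudo-metric the choice of representatives is irrelevant. *)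
Definition reduced_repr d (C : reduced d) : X := projT1 (cid (proj2_sig C)).

Definition reduced_dist d (C D : reduced d) : R :=
  d (reduced_repr C) (reduced_repr D).

End Metric.

(** * The randomization signature and theory *)

(* Pre-structures for the randomization signature.  The symbol attached to phi
   has one argument for each free variable of phi, in the order of [fv phi].
   As usual in continuous logic, a symbol is 1-Lipschitz when it is so in each
   argument separately; for the distance predicates this is the triangle
   inequality, and for [neg] and [mu] there is only one argument. *)
Record rprestructure (R : realType) (L : signature) := RPreStructure {
  rK : Type;
  rB : Type;
  rK_inhabited : inhabited rK;
  dK : rK -> rK -> R;
  dB : rB -> rB -> R;
  mu : rB -> R;
  top : rB;
  bot : rB;
  join : rB -> rB -> rB;
  meet : rB -> rB -> rB;
  neg : rB -> rB;
  fsem : forall phi : formula L, (size (fv phi)).-tuple rK -> rB;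
  dK_pseudometric : pseudometric01 dK;
  dB_pseudometric : pseudometric01 dB;
  mu_bounded : forall U, 0 <= mu U <= 1;
  mu_lipschitz : forall U V, `|mu U - mu V| <= dB U V;
  join_lipschitzl : forall U V W, dB (join U W) (join V W) <= dB U V;
  join_lipschitzr : forall U V W, dB (join W U) (join W V) <= dB U V;
  meet_lipschitzl : forall U V W, dB (meet U W) (meet V W) <= dB U V;
  meet_lipschitzr : forall U V W, dB (meet W U) (meet W V) <= dB U V;
  neg_lipschitz : forall U V, dB (neg U) (neg V) <= dB U V;
  fsem_lipschitz : forall (phi : formula L) (i : 'I_(size (fv phi)))
      (s t : (size (fv phi)).-tuple rK),
    (forall j, j != i -> tnth s j = tnth t j) ->
    dB (fsem s) (fsem t) <= dK (tnth s i) (tnth t i) }.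

Arguments top {R L} _.
Arguments bot {R L} _.

Notation "U ≐ V" := (dB U V = 0) (at level 70).

Section Randomization.
Context {R : realType} {L : signature}.
Implicit Types (M : rprestructure R L) (T : set (formula L)).

(* The event [[phi(xs)]], where e gives the values of the variables; only
   the values at the free variables of phi matter. *)
Definition event M (phi : formula L) (e : nat -> rK M) : rB M :=
  fsem (map_tuple e (in_tuple (fv phi))).

Definition eqv (x y : nat) : formula L := Eq (Var x) (Var y).

Definition symdiff M (U V : rB M) : rB M :=
  join (meet U (neg V)) (meet (neg U) V).

Definition validity_axiom M : Prop :=
  forall psi : formula L, logically_valid (uclosure psi) ->
    sup [set dB (event psi e) (top M) | e in [set: nat -> rK M]] = 0.

Definition boolean_algebra_axiom M : Prop :=
  [/\ (forall U V : rB M, join U V ≐ join V U) /\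
        (forall U V : rB M, meet U V ≐ meet V U),
      (forall U V W : rB M, join U (join V W) ≐ join (join U V) W) /\
        (forall U V W : rB M, meet U (meet V W) ≐ meet (meet U V) W),
      (forall U V : rB M, join U (meet U V) ≐ U) /\
        (forall U V : rB M, meet U (join U V) ≐ U),
      (forall U V W : rB M,
          join U (meet V W) ≐ meet (join U V) (join U W)) /\
        (forall U V W : rB M,
          meet U (join V W) ≐ join (meet U V) (meet U W)) &
      (forall U : rB M, join U (neg U) ≐ top M) /\
        (forall U : rB M, meet U (neg U) ≐ bot M)].

Definition boolean_axiom M : Prop :=
  [/\ boolean_algebra_axiom M,
      forall (phi : formula L) (e : nat -> rK M),
        event (Not phi) e ≐ neg (event phi e),
      forall (phi psi : formula L) (e : nat -> rK M),
        event (Or phi psi) e ≐ join (event phi e) (event psi e) &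
      forall (phi psi : formula L) (e : nat -> rK M),
        event (And phi psi) e ≐ meet (event phi e) (event psi e)].

(* [[x = y]] is a different symbol for each choice of variables x and y,
   hence the quantification over x and y here and below. *)
Definition distance_axiom M : Prop :=
  (forall (x y : nat) (e : nat -> rK M),
      dK (e x) (e y) = 1 - mu (event (eqv x y) e)) /\
  (forall U V : rB M, dB U V = mu (symdiff U V)).

Definition fullness_axiom M : Prop :=
  forall (phi : formula L) (x : nat),
    sup [set inf [set dB (event phi (upd e x a)) (event (Ex x phi) e)
                 | a in [set: rK M]]
        | e in [set: nat -> rK M]] = 0.

Definition event_axiom M : Prop :=
  forall x y : nat, x != y ->
    sup [set inf [set dB U (event (eqv x y) e) | e in [set: nat -> rK M]]
        | U in [set: rB M]] = 0.

Definition measure_axiom M : Prop :=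
  [/\ mu (top M) = 1, mu (bot M) = 0 &
      forall U V : rB M, mu U + mu V = mu (join U V) + mu (meet U V)].

Definition atomless_axiom M : Prop :=
  sup [set inf [set `|mu (meet U V) - mu U / 2| | V in [set: rB M]]
      | U in [set: rB M]] = 0.

Definition transfer_axiom T M : Prop :=
  forall phi : formula L, T phi ->
    forall e : nat -> rK M, event phi e ≐ top M.

Record rpremodel T M : Prop := RPreModel {
  rpremodel_validity : validity_axiom M;
  rpremodel_boolean : boolean_axiom M;
  rpremodel_distance : distance_axiom M;
  rpremodel_fullness : fullness_axiom M;
  rpremodel_event : event_axiom M;
  rpremodel_measure : measure_axiom M;
  rpremodel_atomless : atomless_axiom M;
  rpremodel_transfer : transfer_axiom T M }.

Definition pre_complete M : Prop :=
  complete_dist (@reduced_dist _ _ (@dK _ _ M)) /\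
  complete_dist (@reduced_dist _ _ (@dB _ _ M)).

Definition is_structure M : Prop :=
  [/\ separated (@dK _ _ M), separated (@dB _ _ M),
      complete_dist (@dK _ _ M) & complete_dist (@dB _ _ M)].

Definition rmodel T M : Prop := rpremodel T M /\ is_structure M.

Definition perfect_witnesses M : Prop :=
  (forall (phi : formula L) (x : nat) (e : nat -> rK M),
      exists f : rK M, event phi (upd e x f) ≐ event (Ex x phi) e) /\
  (forall (x y : nat), x != y -> forall U : rB M,
      exists e : nat -> rK M, U ≐ event (eqv x y) e).

End Randomization.

(* Main.v *)
Require Import Defs.
From mathcomp Require Import all_boot all_order all_algebra.
From mathcomp Require Import boolp classical_sets reals.
From mathcomp Require Import lra.
Import Order.TTheory GRing.Theory Num.Theory.
Local Open Scope classical_set_scope.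
Local Open Scope ring_scope.

(** The validity axiom turns first order entailments into inequalities between
    the measures of events, so all Boolean computations in the event sort are
    done inside formulas.  A nonnegative 1-Lipschitz function [F] on a complete
    pseudo-metric space has a zero as soon as every [x] and [eps > 0] admit some
    [y] with [F y < eps] and [d x y < F x + eps].  Both kinds of witnesses are
    zeros of such functions on the sort of random elements: the measure of the
    event where [f] fails to satisfy a formula, and the distance from [U] to
    [[k = f]].  The improved point [y] is an approximate witness, given by the
    fullness axiom, of a formula saying that [y] is correct and that it equals
    [x] wherever [x] was already correct.  Two almost surely distinct random
    elements come from the event axiom applied to the bottom event. *)

(** * Pseudo-metrics *)

Section Pseudometric.
Context {R : realType} {X : Type}.
Implicit Types (d : X -> X -> R) (u : nat -> X).

Lemma half_expr_small (eps : R) : 0 < eps ->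
  exists N, forall n, (N <= n)%N -> 2^-1 ^+ n < eps.
Proof.
move=> eps0; exists (Num.truncn eps^-1).+1 => n Nn.
rewrite exprVn invf_plt ?posrE ?exprn_gt0 //.
apply: (lt_le_trans (truncnS_gt _)).
by rewrite -natrX ler_nat (leq_trans Nn) // ltnW // ltn_expl.
Qed.

Lemma cauchy_seq_geometric d u (C : R) : pseudometric01 d -> 0 <= C ->
  (forall n, d (u n) (u n.+1) <= C * 2^-1 ^+ n) -> cauchy_seq d u.
Proof.
move=> [d01 dxx dC dtri] C0 du eps eps0.
(* The right-hand side is the exact partial sum of the geometric series, so the induction loses
   nothing. *)
have step n k : d (u n) (u (n + k)%N) <= 2 * C * (2^-1 ^+ n - 2^-1 ^+ (n + k)).
  elim: k => [|k IHk]; first by rewrite addn0 dxx subrr mulr0.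
  apply: (le_trans (dtri _ (u (n + k)%N) _)).
  have := du (n + k)%N; rewrite addnS exprS; move: IHk; nra.
(* The added 1 keeps the divisor positive when [C] is 0. *)
have C1 : 0 < 2 * C + 1 by lra.
have eps1 : 0 < eps / 2 / (2 * C + 1) by rewrite !divr_gt0.
have [N /(_ N (leqnn N))] := half_expr_small _ eps1.
rewrite ltr_pdivlMr // => CN.
exists N => m n Nm Nn.
have uNk k : (N <= k)%N -> d (u N) (u k) < eps / 2.
  move=> Nk; have := step N (k - N)%N; rewrite subnKC //.
  have : 0 <= 2^-1 ^+ N :> R by rewrite exprn_ge0 ?invr_ge0.
  have : 0 <= 2^-1 ^+ k :> R by rewrite exprn_ge0 ?invr_ge0.
  move: CN; nra.
apply: (le_lt_trans (dtri _ (u N) _)).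
by have := uNk _ Nm; have := uNk _ Nn; rewrite (dC (u m)); lra.
Qed.

(** Improving with errors [2^-n] gives points where [F] is below [2^-n] and whose consecutive
    distances are at most [2 * 2^-n]. The sequence is Cauchy, and the Lipschitz bound makes [F]
    vanish at its limit. *)
Lemma complete_exists_zero d (F : X -> R) (x0 : X) :
  pseudometric01 d -> complete_dist d ->
  (forall x, 0 <= F x) -> (forall x y, F y <= F x + d x y) ->
  (forall x (eps : R), 0 < eps -> exists y, F y < eps /\ d x y < F x + eps) ->
  exists x, F x = 0.
Proof.
move=> dP dcomplete F0 Flip improve.
have p2 n : 0 < 2^-1 ^+ n :> R by rewrite exprn_gt0 // invr_gt0.
pose s n x : X := projT1 (cid (improve x _ (p2 n))).
have sP n x : F (s n x) < 2^-1 ^+ n /\ d x (s n x) < F x + 2^-1 ^+ n.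
  exact: (projT2 (cid (improve x _ (p2 n)))).
pose h := fix h n := if n is m.+1 then s m.+1 (h m) else s 0 x0.
have hF n : F (h n) < 2^-1 ^+ n by case: n => [|n]; exact: (proj1 (sP _ _)).
have hd n : d (h n) (h n.+1) <= 2 * 2^-1 ^+ n.
  have [_ /=] := sP n.+1 (h n); have := hF n; have := p2 n.
  rewrite exprS; lra.
have [l hl] := dcomplete _ (cauchy_seq_geometric _ _ _ dP (ler0n _ 2) hd).
exists l; apply/eqP; rewrite eq_le F0 andbT; apply/ler_addgt0Pr => eps eps0.
have eps2 : 0 < eps / 2 by lra.
have [N hN] := hl _ eps2.
have [m hm] := half_expr_small _ eps2.
pose n := maxn N m.
have dn : d (h n) l < eps / 2 by apply: hN; rewrite leq_maxl.
have Fn : 2^-1 ^+ n < eps / 2 by apply: hm; rewrite leq_maxr.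
have := Flip (h n) l; have := hF n; lra.
Qed.

Lemma complete_reduced d : pseudometric01 d ->
  complete_dist (@reduced_dist R X d) -> complete_dist d.
Proof.
move=> [d01 dxx dC dtri] dcomplete u ucauchy.
pose C n : reduced d := exist _ _ (ex_intro _ (u n) erefl).
(* The chosen representative of the class of [u n] may be another point, but at distance 0. *)
have uC n : d (u n) (reduced_repr (C n)) = 0.
  rewrite /reduced_repr; case: cid => y /= Cy.
  have : [set z | d y z = 0] y by rewrite /= dxx.
  by rewrite -Cy.
have [|D CD] := dcomplete C.
  move=> eps /ucauchy[N hN]; exists N => m n Nm Nn.
  apply: le_lt_trans (hN m n Nm Nn); rewrite /reduced_dist.
  have := dtri (reduced_repr (C m)) (u m) (reduced_repr (C n)).
  have := dtri (u m) (u n) (reduced_repr (C n)).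
  by rewrite (dC _ (u m)) !uC; lra.
exists (reduced_repr D) => eps /CD[N hN]; exists N => n Nn.
apply: le_lt_trans (hN n Nn); rewrite /reduced_dist.
by have := dtri (u n) (reduced_repr (C n)) (reduced_repr D); rewrite uC add0r.
Qed.

End Pseudometric.

(** * Vanishing suprema and infima of bounded families *)

(** The bound [c] rules out that the value 0 is only the default of [sup] on an unbounded set. *)
Lemma sup_eq0_le (R : realType) (A : Type) (F : A -> R) (c : R) :
  (forall a, F a <= c) -> sup [set F a | a in [set: A]] = 0 ->
  forall a, F a <= 0.
Proof.
move=> Fc <- a; apply: sup_upper_bound; last by exists a.
by split; [exists (F a); exists a | exists c => _ [b _ <-]].
Qed.

Lemma inf_le0_approx (R : realType) (A : Type) (F : A -> R) :
  inhabited A -> (forall a, 0 <= F a) ->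
  inf [set F a | a in [set: A]] <= 0 ->
  forall eps, 0 < eps -> exists a, F a < eps.
Proof.
move=> [a0] F0 inf0 eps eps0.
have hasinf : has_inf [set F a | a in [set: A]].
  by split; [exists (F a0); exists a0 | exists 0 => _ [b _ <-]].
have [_ [a _ <-] aeps] := inf_adherent eps0 hasinf.
by exists a; apply: (lt_le_trans aeps); rewrite gerDr.
Qed.

Lemma sup_inf_eq0_approx (R : realType) (A B : Type) (F : A -> B -> R) :
  inhabited B -> (forall a b, 0 <= F a b <= 1) ->
  sup [set inf [set F a b | b in [set: B]] | a in [set: A]] = 0 ->
  forall a eps, 0 < eps -> exists b, F a b < eps.
Proof.
move=> [b0] F01 supinf0 a; apply: inf_le0_approx => //.
  by move=> b; have /andP[] := F01 a b.
apply: (@sup_eq0_le _ _ (fun a => inf [set F a b | b in [set: B]]) 1) => // a'.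
have /andP[_ Fb0] := F01 a' b0; apply: le_trans Fb0.
apply: ge_inf; last by exists b0.
by exists 0 => _ [b _ <-]; have /andP[] := F01 a' b.
Qed.

(** * First order semantics *)

Section Semantics.
Context {L : signature}.
Implicit Types (p q : formula L).

(** The fold yields curried implications, so for a concrete list a proof introduces the premises one
    by one. *)
Definition entails (ps : seq (formula L)) q : Prop :=
  forall (A : fo_structure L) (e : nat -> A),
    foldr (fun p P => sat e p -> P) (sat e q) ps.

Definition Xor p q : formula L := Or (And p (Not q)) (And (Not p) q).

Lemma fv_uniq p : uniq (fv p).
Proof. by elim: p => *; rewrite /= ?undup_uniq ?filter_uniq. Qed.

Lemma notin_fv_Ex x p : x \notin fv (Ex x p).
Proof. by rewrite mem_filter eqxx. Qed.

Lemma upd_upd (X : Type) (e : nat -> X) x a b :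
  upd (upd e x a) x b = upd e x b.
Proof. by apply: funext => y; rewrite /upd; case: eqP. Qed.

Lemma upd_id (X : Type) (e : nat -> X) x : upd e x (e x) = e.
Proof. by apply: funext => y; rewrite /upd; case: eqP => // ->. Qed.

Lemma updE (X : Type) (e : nat -> X) x a : upd e x a x = a.
Proof. by rewrite /upd eqxx. Qed.

Lemma upd_neq (X : Type) (e : nat -> X) x a y : y != x -> upd e x a y = e y.
Proof. by rewrite /upd => /negPf->. Qed.

Lemma logically_valid_uclosure p : entails [::] p -> logically_valid (uclosure p).
Proof.
move=> pval A e; rewrite /uclosure.
by elim: (fv p) e => [|x s IHs] e /=; [apply: pval | move=> a; apply: IHs].
Qed.

Lemma fresh_variable (s : seq nat) : exists z, z \notin s.
Proof.
exists (\max_(i <- s) i).+1; apply/negP => zs.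
by have := leq_bigmax_seq (P := xpredT) (F := id) _ zs isT; rewrite ltnn.
Qed.

End Semantics.

(** * Probabilities of formulas in a pre-model *)

Section Premodel.
Context {R : realType} {L : signature} {T : set (formula L)}.
Context {M : rprestructure R L} (MT : rpremodel T M).
Implicit Types (p q r : formula L) (e : nat -> rK M).

Definition prob p e : R := mu (event p e).

Let dB_ge0 (U V : rB M) : 0 <= dB U V.
Proof. by have [/(_ U V)/andP[]] := dB_pseudometric M. Qed.

Let dB_tri (U V W : rB M) : dB U W <= dB U V + dB V W.
Proof. by have [_ _ _] := dB_pseudometric M. Qed.

Let dB_sym (U V : rB M) : dB U V = dB V U.
Proof. by have [_ _ ->] := dB_pseudometric M. Qed.

Let dB_id (U : rB M) : dB U U = 0.
Proof. by have [_ ->] := dB_pseudometric M. Qed.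

Let dK_id (f : rK M) : dK f f = 0.
Proof. by have [_ ->] := dK_pseudometric M. Qed.

Lemma mu_congr (U V : rB M) : U ≐ V -> mu U = mu V.
Proof.
move=> UV; have := mu_lipschitz U V.
by rewrite UV normr_le0 subr_eq0 => /eqP.
Qed.

Lemma eq_event p e e' : {in fv p, e =1 e'} -> event p e = event p e'.
Proof.
move=> ee'; rewrite /event; congr fsem; apply: val_inj => /=.
exact/eq_in_map.
Qed.

Lemma event_upd_notin p e x f : x \notin fv p -> event p (upd e x f) = event p e.
Proof.
move=> xp; apply: eq_event => y yp; rewrite upd_neq //.
by apply: contraNneq xp => <-.
Qed.

Lemma prob_upd_notin p e x f : x \notin fv p -> prob p (upd e x f) = prob p e.
Proof. by move=> xp; rewrite /prob event_upd_notin. Qed.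

(** The list [fv p] has no repetition, so changing the value of [x] changes a single argument of the
    symbol, the one at the index of [x]. *)
Lemma event_upd_lipschitz p e x f g :
  dB (event p (upd e x f)) (event p (upd e x g)) <= dK f g.
Proof.
have [xp|xp] := boolP (x \in fv p); last first.
  rewrite !event_upd_notin // dB_id.
  by have [/(_ f g)/andP[]] := dK_pseudometric M.
have ip : (index x (fv p) < size (fv p))%N by rewrite index_mem.
have tE h j : tnth (map_tuple (upd e x h) (in_tuple (fv p))) j
    = upd e x h (nth 0%N (fv p) j).
  by rewrite tnth_map (tnth_nth 0%N).
rewrite /event; apply: (le_trans (fsem_lipschitz (i := Ordinal ip) _)) => [j ji|].
  suff jx : nth 0%N (fv p) j != x by rewrite !tE !upd_neq.
  by apply: contra ji => /eqP jx; rewrite -val_eqE /= -jx index_uniq ?fv_uniq.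
by rewrite !tE /= nth_index // !updE.
Qed.

Lemma prob_upd_lipschitz p e x f g :
  prob p (upd e x f) <= prob p (upd e x g) + dK f g.
Proof.
rewrite addrC -lerBlDr.
apply: le_trans (event_upd_lipschitz p e x f g).
exact: le_trans (ler_norm _) (mu_lipschitz _ _).
Qed.

Lemma prob_ge0 p e : 0 <= prob p e.
Proof. by have /andP[] := mu_bounded (event p e). Qed.

Lemma prob_le1 p e : prob p e <= 1.
Proof. by have /andP[] := mu_bounded (event p e). Qed.

Lemma probNot p e : prob (Not p) e = 1 - prob p e.
Proof.
have [[_ _ _ _ [joinN meetN]] notE _ _] := rpremodel_boolean MT.
have [mu1 mu0 muD] := rpremodel_measure MT.
have := muD (event p e) (neg (event p e)).
rewrite /prob (mu_congr _ _ (notE p e)) (mu_congr _ _ (joinN _)).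
by rewrite (mu_congr _ _ (meetN _)) mu1 mu0; lra.
Qed.

Lemma prob_OrAnd p q e :
  prob (Or p q) e + prob (And p q) e = prob p e + prob q e.
Proof.
have [_ _ orE andE] := rpremodel_boolean MT.
have [_ _ muD] := rpremodel_measure MT.
by rewrite /prob (mu_congr _ _ (orE p q e)) (mu_congr _ _ (andE p q e)) -muD.
Qed.

Lemma prob_valid p e : entails [::] p -> prob p e = 1.
Proof.
move=> pval; have [mu1 _ _] := rpremodel_measure MT; rewrite -mu1.
apply: mu_congr; apply/eqP; rewrite eq_le dB_ge0 andbT.
apply: (@sup_eq0_le R _ (fun e => dB (event p e) (top M)) 1) => [e'|].
  by have [/(_ (event p e') (top M))/andP[]] := dB_pseudometric M.
exact/(rpremodel_validity MT)/logically_valid_uclosure.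
Qed.

Lemma prob_entails1 p q e : entails [:: p] q -> prob p e <= prob q e.
Proof.
move=> pq; have : prob (Or (Not p) q) e = 1.
  apply: prob_valid => A a /=.
  by have [/pq|] := pselect (sat a p); [right | left].
have := prob_OrAnd (Not p) q e; rewrite probNot.
by have := prob_ge0 (And (Not p) q) e; lra.
Qed.

(** Inclusion-exclusion, as [Or p q] has probability at most 1. When one premise is almost sure, the
    other bounds [r] with no loss. *)
Lemma prob_entails2 p q r e :
  entails [:: p; q] r -> prob p e + prob q e - 1 <= prob r e.
Proof.
move=> pqr; have : prob (And p q) e <= prob r e.
  by apply: prob_entails1 => A a [/pqr].
by have := prob_OrAnd p q e; have := prob_le1 (Or p q) e; lra.
Qed.

Lemma prob_eqv x y e : prob (eqv x y) e = 1 - dK (e x) (e y).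
Proof. by have [dKE _] := rpremodel_distance MT; rewrite dKE /prob; lra. Qed.

(** [Xor] mirrors [symdiff]. The Boolean operations respect distance 0 because they are 1-Lipschitz,
    so event symbols can be traded for operations through the triangle inequality. *)
Lemma dB_event p q e : dB (event p e) (event q e) = prob (Xor p q) e.
Proof.
have [_ dBE] := rpremodel_distance MT.
have [_ notE orE andE] := rpremodel_boolean MT.
rewrite dBE; apply: mu_congr; apply/eqP; rewrite eq_le dB_ge0 andbT.
rewrite dB_sym /Xor.
apply: (le_trans (dB_tri _ (join (event (And p (Not q)) e)
  (event (And (Not p) q) e)) _)); rewrite orE add0r.
apply: (le_trans (dB_tri _ (join (meet (event p e) (neg (event q e)))
   (event (And (Not p) q) e)) _)).
have h1 : dB (event (And p (Not q)) e) (meet (event p e) (neg (event q e))) <= 0.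
  apply: (le_trans (dB_tri _ (meet (event p e) (event (Not q) e)) _)).
  by rewrite andE add0r; apply: (le_trans (meet_lipschitzr _ _ _)); rewrite notE.
have h2 : dB (event (And (Not p) q) e) (meet (neg (event p e)) (event q e)) <= 0.
  apply: (le_trans (dB_tri _ (meet (event (Not p) e) (event q e)) _)).
  by rewrite andE add0r; apply: (le_trans (meet_lipschitzl _ _ _)); rewrite notE.
have := join_lipschitzl (event (And p (Not q)) e)
  (meet (event p e) (neg (event q e))) (event (And (Not p) q) e).
have := join_lipschitzr (event (And (Not p) q) e)
  (meet (neg (event p e)) (event q e)) (meet (event p e) (neg (event q e))).
lra.
Qed.

(** * Approximate witnesses and renaming in equality events *)

Lemma fullness_approx p x e (eps : R) : 0 < eps ->
  exists f, prob (Ex x p) e - eps < prob p (upd e x f).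
Proof.
move=> eps0.
pose F e f := dB (event p (upd e x f)) (event (Ex x p) e).
have [||f] := @sup_inf_eq0_approx R _ _ F (rK_inhabited M) _ _ e eps eps0.
- by move=> e' f; have [d01 _ _ _] := dB_pseudometric M; exact: d01.
- exact: (rpremodel_fullness MT).
move=> fe; exists f; rewrite ltrBlDr addrC -ltrBlDr; apply: le_lt_trans fe.
rewrite /F dB_sym; exact: le_trans (ler_norm _) (mu_lipschitz _ _).
Qed.

Lemma event_approx (U : rB M) (eps : R) : 0 < eps ->
  exists e, dB U (event (eqv 0 1) e) < eps.
Proof.
move=> eps0; have [k0] := rK_inhabited M.
pose F (U : rB M) e := dB U (event (eqv 0 1) e).
apply: (@sup_inf_eq0_approx R _ _ F) => //.
- by move=> V e; have [d01 _ _ _] := dB_pseudometric M; exact: d01.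
- exact: (rpremodel_event MT).
Qed.

Lemma event_eqv_fresh x y x' y' e e' :
  x' \notin [:: x; y] -> y' \notin [:: x; y] -> e x = e' x' -> e y = e' y' ->
  event (eqv x y) e ≐ event (eqv x' y') e'.
Proof.
move=> x'xy y'xy exx' eyy'.
(* One assignment extends both [e] on [x, y] and [e'] on [x', y']. Under it [x = x'] and [y = y']
   are almost sure, so the two equations agree almost surely. *)
pose E n := if n \in [:: x; y] then e n else e' n.
have -> : event (eqv x y) e = event (eqv x y) E.
  by apply: eq_event => n; rewrite mem_undup /E => ->.
have -> : event (eqv x' y') e' = event (eqv x' y') E.
  apply: eq_event => n; rewrite mem_undup /= !inE /E.
  by case/orP => /eqP->; rewrite ?(negPf x'xy) ?(negPf y'xy).
rewrite dB_event.
have : prob (eqv x x') E + prob (eqv y y') E - 1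
    <= prob (Not (Xor (eqv x y) (eqv x' y'))) E.
  apply: prob_entails2 => A a /= -> ->; tauto.
rewrite !prob_eqv probNot /E (negPf x'xy) (negPf y'xy) !inE !eqxx orbT /=.
rewrite exx' eyy' !dK_id.
by have := prob_ge0 (Xor (eqv x y) (eqv x' y')) E; rewrite /E; lra.
Qed.

(** Passing through two fresh variables allows the two pairs to overlap. *)
Lemma event_eqv_rename x y x' y' e e' : e x = e' x' -> e y = e' y' ->
  event (eqv x y) e ≐ event (eqv x' y') e'.
Proof.
move=> exx' eyy'.
have [z] := fresh_variable [:: x; y; x'; y'].
have [w] := fresh_variable [:: z; x; y; x'; y'].
rewrite !inE !negb_or => /and5P[wz wx wy wx' wy'] /and4P[zx zy zx' zy'].
pose E n := if n == z then e x else e y.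
have h1 : event (eqv x y) e ≐ event (eqv z w) E.
  apply: event_eqv_fresh; rewrite ?inE ?negb_or ?zx ?zy ?wx ?wy //.
    by rewrite /E eqxx.
  by rewrite /E (negPf wz).
have h2 : event (eqv x' y') e' ≐ event (eqv z w) E.
  apply: event_eqv_fresh; rewrite ?inE ?negb_or ?zx' ?zy' ?wx' ?wy' //.
    by rewrite /E eqxx.
  by rewrite /E (negPf wz).
apply/eqP; rewrite eq_le dB_ge0 andbT.
by apply: (le_trans (dB_tri _ (event (eqv z w) E) _)); rewrite h1 dB_sym h2 addr0.
Qed.

(** * Exact witnesses *)

Context (Kcomplete : complete_dist (@dK _ _ M)).

(* An approximate witness [h] is improved to [h'] which satisfies [p] and
   agrees with [h] wherever [h] satisfies [p]; [theta] expresses this. *)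
Lemma prob_Ex_witness p x e :
  prob (Ex x p) e = 1 -> exists f, prob p (upd e x f) = 1.
Proof.
move=> Exp; have [k0] := rK_inhabited M.
pose F f : R := 1 - prob p (upd e x f).
suff [f Ff] : exists f, F f = 0 by exists f; rewrite /F in Ff; lra.
apply: (complete_exists_zero _ _ k0 (dK_pseudometric M) Kcomplete).
- by move=> f; rewrite /F subr_ge0 prob_le1.
- by move=> f g; have := prob_upd_lipschitz p e x f g; rewrite /F; lra.
move=> h eps eps0.
(* The variable [z] carries the old approximation [h]. *)
have [z] := fresh_variable (x :: fv p); rewrite inE negb_or => /andP[zx zp].
(* This is [p] with [z] substituted for [x], written without a substitution operation. *)
pose pz := Ex x (And (eqv x z) p).
pose theta := And p (Or (Not pz) (eqv x z)).
have Extheta : prob (Ex x theta) (upd e z h) = 1.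
  apply/eqP; rewrite eq_le prob_le1 /= -Exp.
  rewrite -(prob_upd_notin (Ex x p) e z h); last first.
    by rewrite /= mem_filter negb_and zp orbT.
  apply: prob_entails1 => A a /= [b pb].
  have [[c [cz pc]]|npz] := pselect (sat a pz).
    by exists c; split=> //; right.
  exists b; split=> //; left => -[c]; rewrite upd_upd => hc.
  by apply: npz; exists c.
have [h'] := fullness_approx theta x (upd e z h) eps eps0.
rewrite Extheta; set E := upd _ x h' => thetaE.
have pE f : prob p (upd (upd e z h) x f) = prob p (upd e x f).
  congr mu; apply: eq_event => y yp; rewrite /upd.
  by case: (y == x) => //; case: eqP yp zp => // -> ->.
exists h'; split.
  have : prob theta E <= prob p E by apply: prob_entails1 => A a [].
  by rewrite pE /F; lra.
(* Where [theta] and [pz] both hold, the new element equals [h]. As [pz] is at least as probable as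
   [p] at [h], the distance moved is below [F h + eps]. *)
have : prob theta E + prob pz E - 1 <= prob (eqv x z) E.
  by apply: prob_entails2 => A a [_ []].
have <- : prob pz (upd (upd e z h) x h) = prob pz E.
  by rewrite /E !(prob_upd_notin pz _ x) ?notin_fv_Ex.
have : prob (eqv x z) (upd (upd e z h) x h) + prob p (upd (upd e z h) x h) - 1
    <= prob pz (upd (upd e z h) x h).
  by apply: prob_entails2 => A a eqa pa; exists (a x); rewrite upd_id.
rewrite !prob_eqv pE !updE !(upd_neq _ _ _ _ _ zx) !updE dK_id.
have [_ _ -> _] := dK_pseudometric M.
have -> : E x = h' by rewrite /E updE.
have -> : E z = h by rewrite /E upd_neq // updE.
by rewrite /F; lra.
Qed.

(** In a nonempty structure some element satisfies [p] unless none does. An almost sure witness of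
    this valid existential makes [p] and [Ex x p] the same event. *)
Lemma fullness_witness p x e :
  exists f, event p (upd e x f) ≐ event (Ex x p) e.
Proof.
have [f pf] : exists f, prob (Or p (Not (Ex x p))) (upd e x f) = 1.
  apply: prob_Ex_witness; apply: prob_valid => A a /=.
  have [[b pb]|np] := pselect (sat a (Ex x p)); first by exists b; left.
  exists (a x); right => -[b]; rewrite upd_upd => pb; apply: np; by exists b.
exists f; rewrite -(event_upd_notin (Ex x p) e x f (notin_fv_Ex x p)) dB_event.
have : prob (Or p (Not (Ex x p))) (upd e x f)
    <= prob (Not (Xor p (Ex x p))) (upd e x f).
  apply: prob_entails1 => A a /=.
  have pEx : sat a p -> exists b, sat (upd a x b) p.
    by move=> pa; exists (a x); rewrite upd_id.
  tauto.
by rewrite pf probNot; have := prob_ge0 (Xor p (Ex x p)) (upd e x f); lra.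
Qed.

(** Approximating [bot] by an equality event gives two elements that differ with probability close
    to 1. Wherever they differ, one of them differs from [f], so an element other than [f] exists
    almost surely. *)
Lemma exists_dK1 : exists f g : rK M, dK f g = 1.
Proof.
have [f] := rK_inhabited M.
have [|g] := @prob_Ex_witness (Not (eqv 0 1)) 1%N (fun _ => f).
  apply/eqP; rewrite eq_le prob_le1; apply/ler_addgt0Pr => eps eps0.
  have [e botE] := event_approx (bot M) eps eps0.
  (* Variable 0 carries [f], and variables 2 and 3 the two elements that mostly differ. *)
  pose E n := if n == 0%N then f else if n == 2%N then e 0%N else e 1%N.
  have -> : prob (Ex 1 (Not (eqv 0 1))) (fun _ => f)
      = prob (Ex 1 (Not (eqv 0 1))) E.
    by congr mu; apply: eq_event => n; rewrite inE => /eqP->.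
  have : prob (Not (eqv 2 3)) E <= prob (Ex 1 (Not (eqv 0 1))) E.
    apply: prob_entails1 => A a /= a23; rewrite /upd /=.
    have [a02|a02] := pselect (a 0%N = a 2%N); last by exists (a 2%N).
    by exists (a 3%N); rewrite a02.
  have := mu_lipschitz (bot M) (event (eqv 0 1) e).
  have [_ -> _] := rpremodel_measure MT.
  rewrite sub0r normrN => /(le_trans (ler_norm _)).
  rewrite -/(prob (eqv 0 1) e) probNot !prob_eqv /E /=; lra.
rewrite probNot prob_eqv /upd /= => fg; exists f, g; lra.
Qed.

(* Fix [f] and [g] almost surely distinct.  Given [k] and an approximation
   [[a = b]] of [U], the random element equal to [f] on [[a = b]], to [g] on
   [[a <> b /\ k = f]] and to [k] elsewhere differs from [k] only on the
   symmetric difference of [[a = b]] and [[k = f]]. *)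
Lemma event_witness x y (U : rB M) : x != y ->
  exists e, U ≐ event (eqv x y) e.
Proof.
move=> xy; have [f [g fg]] := exists_dK1.
(* Under [e0 k] the formula [eqv 0 1] expresses [k = f]; renaming then transfers a solution to [x]
   and [y]. *)
pose e0 k := upd (fun _ => f) 0 k.
suff [k Uk] : exists k, dB U (event (eqv 0 1) (e0 k)) = 0.
  exists (upd (fun _ => f) x k).
  apply/eqP; rewrite eq_le dB_ge0 andbT.
  apply: (le_trans (dB_tri _ (event (eqv 0 1) (e0 k)) _)); rewrite Uk add0r.
  by rewrite event_eqv_rename // /e0 ?updE // !upd_neq // eq_sym.
apply: (complete_exists_zero _ _ f (dK_pseudometric M) Kcomplete).
- by move=> k; exact: dB_ge0.
- move=> k k'; apply: (le_trans (dB_tri _ (event (eqv 0 1) (e0 k)) _)).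
  by rewrite lerD2l event_upd_lipschitz.
move=> k eps eps0.
have [e Ue] := event_approx U eps eps0.
(* Variables 0 and 1 carry the approximation of [U], then 2, 3, 4 carry [k], [f], [g]; 5 is kept for
   the new element. *)
pose E := upd (upd (upd e 2 k) 3 f) 4 g.
pose theta : formula L :=
  Or (And (eqv 0 1) (eqv 5 3))
     (And (Not (eqv 0 1)) (Or (And (eqv 2 3) (eqv 5 4))
                              (And (Not (eqv 2 3)) (eqv 5 2)))).
have [|k'] := @prob_Ex_witness theta 5 E.
  apply: prob_valid => A a; rewrite /= /upd /=.
  have [a01|a01] := pselect (a 0%N = a 1%N); first by exists (a 3%N); left.
  have [a23|a23] := pselect (a 2%N = a 3%N).
    by exists (a 4%N); right; split=> //; left.
  by exists (a 2%N); right; split=> //; right.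
set E' := upd E 5 k' => thetaE'.
have E01 : event (eqv 0 1) E' = event (eqv 0 1) e.
  by apply: eq_event => -[|[|]].
have E34 : prob (Not (eqv 3 4)) E' = 1 by rewrite probNot prob_eqv /= fg; lra.
have Ek' : event (eqv 5 3) E' ≐ event (eqv 0 1) (e0 k').
  exact: event_eqv_rename.
have Ek : event (eqv 0 1) (e0 k) ≐ event (eqv 2 3) E'.
  exact: event_eqv_rename.
exists k'; split.
  (* As [f] and [g] differ almost surely, [theta] makes the new element equal [f] exactly on the
     approximation of [U]. *)
  have : prob theta E' + prob (Not (eqv 3 4)) E' - 1
      <= prob (Not (Xor (eqv 0 1) (eqv 5 3))) E'.
    apply: prob_entails2 => A a /=; intuition congruence.
  rewrite thetaE' E34 probNot -dB_event E01.
  have := dB_tri U (event (eqv 0 1) e) (event (eqv 0 1) (e0 k')).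
  have := dB_tri (event (eqv 0 1) e) (event (eqv 5 3) E')
    (event (eqv 0 1) (e0 k')).
  lra.
(* Where [k = f] agrees with the approximation of [U], [theta] leaves [k] unchanged; this bounds the
   distance moved. *)
have : prob theta E' + prob (Not (Xor (eqv 2 3) (eqv 0 1))) E' - 1
    <= prob (eqv 2 5) E'.
  apply: prob_entails2 => A a /=.
  have := pselect (a 2%N = a 3%N); have := pselect (a 0%N = a 1%N).
  intuition congruence.
rewrite thetaE' probNot -dB_event E01 prob_eqv.
have -> : E' 2%N = k by [].
have -> : E' 5%N = k' by [].
have := dB_tri (event (eqv 2 3) E') U (event (eqv 0 1) e).
have := dB_tri U (event (eqv 0 1) (e0 k)) (event (eqv 2 3) E').
rewrite (dB_sym _ U); lra.
Qed.

Lemma perfect_witnesses_complete : perfect_witnesses M.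
Proof.
split=> [p x e|x y xy U]; first exact: fullness_witness.
exact: event_witness.
Qed.

End Premodel.

Theorem theorem2p7 (R : realType) (L : signature) (T : set (formula L))
    (T_sentences : fo_theory T)
    (T_two : forall A : fo_structure L, fo_model T A -> exists a b : A, a <> b) :
  (forall M : rprestructure R L,
      rpremodel T M -> pre_complete M -> perfect_witnesses M) /\
  (forall M : rprestructure R L, rmodel T M -> perfect_witnesses M).
Proof.
split=> M.
  move=> MT [Kcomplete _]; apply: (perfect_witnesses_complete MT).
  exact: complete_reduced (dK_pseudometric M) Kcomplete.
by move=> [MT [_ _ Kcomplete _]]; exact: (perfect_witnesses_complete MT).
Qed.
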